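(* There exists a cyclic necklace grid that does not contain a bidirected necklace grid (as a subgraph).
   Context: $\mathbb N=\{1,2,\dots\}$. Paths in digraphs are finite and directed. An out-ray is a digraph whose underlying undirected graph is a ray (one-way infinite path) and whose edges are all oriented away from its unique vertex of degree $1$, its root. Necklaces. A necklace is a strongly connected (sub)digraph $N$ for which there is a family $(H_\ell)_{\ell\in\mathbb N}$ of finite strongly connected subgraphs of $N$ such that $N=\bigcup_{\ell}H_\ell$ and, for all $\ell,k$, $H_\ell\cap H_k\ne\emptyset$ if and only if $|\ell-k|\le1$. Such a family is a witness of $N$; the interior of $H_\ell$ is $V(H_\ell)\setminus(V(H_{\ell-1})\cup V(H_{\ell+1}))$ for $\ell>1$. Quarter-grids. Let $(R_i)_{i\in\mathbb N}$ be pairwise disjoint out-rays. For a vertex set $X$ let $\lceil X\rceil$ be the union of $X$ and the set of all vertices $v$ lying on some $R_i$ such that the subray of $R_i$ with root $v$ contains a vertex of $X$; for a subgraph $G$ put $\lceil G\rceil:=\lceil V(G)\rceil$. For a sequence $i_1,\dots,i_n$ of indices ($n\ge 2$), a simple $i_1,\dots,i_n$-staircase is a path that is the concatenation of $P_1,Q_2,P_2,Q_3,\dots,Q_{n-1},P_{n-1}$, each consisting of exactly one edge, where $P_j$ is an edge from $R_{i_j}$ to $R_{i_{j+1}}$ and $Q_j$ is an edge of $R_{i_j}$ from the end vertex of $P_{j-1}$ to the start vertex of $P_j$. A digraph $Q=\bigcup_{i\in\mathbb N}R_i\cup\bigcup_{n\ge2}G_n$ is considered, where the digraphs $G_n$ (the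 girders) satisfy: $G_n$ avoids $\lceil G_i\rceil$ for all $2\le i<n$; $Q$ has no vertex whose in-degree and out-degree are both one; the first vertex of each $R_i$ lies in no $G_n$. - $Q$ is a bidirected quarter-grid if, for every $n\ge2$, $G_n$ is the concatenation of a simple $1,2,\dots,n$-staircase $S_n'$, an edge of $R_n$ and a simple $n,n-1,\dots,1$-staircase $S_n''$ such that $S_n''$ avoids $\lceil S_n'\rceil$. - $Q$ is an ascending cyclic quarter-grid if, for every $n\ge 2$, $G_n$ is the concatenation of a simple $1,2,\dots,n$-staircase $S_n$, an edge of $R_n$ and an edge $A_n$ from $R_n$ to $R_1$ such that $A_n$ avoids $\lceil S_n\rceil$. - $Q$ is a descending cyclic quarter-grid if, for every $n\ge2$, $G_n$ is the concatenation of an edge $A_n$ from $R_1$ to $R_n$, an edge of $R_n$ and a simple $n,n-1,\dots,1$-staircase $S_n$ such that $S_n$ avoids $\lceil A_n\rceil$. A cyclic quarter-grid is an ascending or a descending one. The $R_i$ are the vertical rays. In a subdivision, edges are replaced by internally disjoint directed paths of the same orientation; its vertical rays are the rays arising from the $R_i$, and its horizontal paths are the (pairwise disjoint) paths arising from the edges joining distinct vertical rays. Necklace grids. A bidirected (respectively cyclic) necklace grid is obtained from a subdivision of a bidirected (respectively cyclic) quarter-grid by replacing each vertical ray by a necklace. That is, it is the union of pairwise disjoint necklaces $N_i$ ($i\in\mathbb N$; the vertical necklaces), replacing the vertical rays $R_i$, each with a fixed witness $(H_\ell^{N_i})_{\ell\in\mathbb N}$, and pairwise disjoint paths $P'$,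 one for each horizontal path $P$, where if $P$ runs from $R_i$ to $R_j$ then $P'$ is a path from $N_i$ to $N_j$ internally disjoint from all the vertical necklaces, such that for every vertical necklace $N$: (a) for every odd $\ell$ there is at most one edge of the grid that is not in $E(N)$ and has its head or tail in $H_\ell^{N}$; (b) for every even $\ell$ there is no edge of the grid that is not in $E(N)$ and has its head or tail in the interior of $H_\ell^N$; (c) the endpoints of the paths $P'$ occur along $N_i$ in the same order as the endpoints of the paths $P$ along $R_i$: if $x$ precedes $y$ on $R_i$ and $x',y'\in V(N_i)$ are the corresponding endpoints, then $x'\in H^{N_i}_k$ and $y'\in H^{N_i}_\ell$ for some odd $k<\ell$. *)

(* Defs.v *)
From Stdlib Require Import Arith List Lia.
Import ListNotations.

Set Implicit Arguments.
Unset Strict Implicit.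
Unset Printing Implicit Defensive.

(** Indices start at 1: indexed families are functions on [nat] whose value at 0
    is irrelevant, and all conditions on them are guarded by [1 <= i]. *)

(** Digraphs may be infinite; they have no loops and no parallel edges. *)

Record digraph (V : Type) := Digraph {
  vert : V -> Prop;
  arc : V -> V -> Prop;
  arc_tail : forall u v, arc u v -> vert u;
  arc_head : forall u v, arc u v -> vert v;
  arc_irrefl : forall u, ~ arc u u
}.

Section Digraphs.
Variable V : Type.
Implicit Types (G H : digraph V) (X Y : V -> Prop).

Definition subgraph G H : Prop :=
  (forall v, vert G v -> vert H v) /\
  (forall u v, arc G u v -> arc H u v).

Definition same_digraph G H : Prop := subgraph G H /\ subgraph H G.

Definition avoids X Y : Prop := forall v, X v -> ~ Y v.

Definition finite_digraph G : Prop :=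
  exists l : list V, forall v, vert G v -> In v l.

Definition Union (I : Type) (A : I -> Prop) (F : I -> digraph V) : digraph V.
Proof.
refine (@Digraph V (fun v => exists i, A i /\ vert (F i) v)
                   (fun u v => exists i, A i /\ arc (F i) u v) _ _ _).
- intros u v [i [Ai Fuv]]; exists i; split; [exact Ai | exact (arc_tail Fuv)].
- intros u v [i [Ai Fuv]]; exists i; split; [exact Ai | exact (arc_head Fuv)].
- intros u [i [_ Fuu]]; exact (arc_irrefl Fuu).
Defined.

Definition union2 G H : digraph V :=
  Union (fun _ : bool => True) (fun b => if b then G else H).

(** A path is given by the sequence of its vertices. *)
Record dipath := Dipath {
  pstart : V;
  ptail : list V;
  path_nodup : NoDup (pstart :: ptail)
}.

Definition pverts (P : dipath) : list V := pstart P :: ptail P.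
Definition pend (P : dipath) : V := last (ptail P) (pstart P).
Definition on_path (P : dipath) : V -> Prop := fun v => In v (pverts P).
Definition inner (P : dipath) : V -> Prop :=
  fun v => on_path P v /\ v <> pstart P /\ v <> pend P.

Definition path_graph (P : dipath) : digraph V.
Proof.
refine (@Digraph V (on_path P)
          (fun u v => exists l1 l2, pverts P = l1 ++ u :: v :: l2) _ _ _).
- intros u v [l1 [l2 E]]; unfold on_path; rewrite E.
  apply in_or_app; right; left; reflexivity.
- intros u v [l1 [l2 E]]; unfold on_path; rewrite E.
  apply in_or_app; right; right; left; reflexivity.
- intros u [l1 [l2 E]].
  pose proof (path_nodup P) as D.
  change (NoDup (pverts P)) in D; rewrite E in D.
  apply NoDup_remove_2 in D; apply D.
  apply in_or_app; right; left; reflexivity.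
Defined.

Definition path_in G (P : dipath) : Prop := subgraph (path_graph P) G.

Definition strongly_connected G : Prop :=
  forall u v, vert G u -> vert G v ->
  exists P, path_in G P /\ pstart P = u /\ pend P = v.

(** An out-ray is given by the sequence of its vertices, starting at its root. *)
Record outray := Outray {
  ray_at : nat -> V;
  ray_inj : forall m n, ray_at m = ray_at n -> m = n
}.

Definition on_ray (r : outray) : V -> Prop := fun v => exists k, ray_at r k = v.
Definition root (r : outray) : V := ray_at r 0.

Definition precedes (r : outray) (x y : V) : Prop :=
  exists m n, m < n /\ ray_at r m = x /\ ray_at r n = y.

Definition ray_graph (r : outray) : digraph V.
Proof.
refine (@Digraph V (on_ray r)
          (fun u v => exists k, ray_at r k = u /\ ray_at r (S k) = v) _ _ _).
- intros u v [k [E _]]; exists k; exact E.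
- intros u v [k [_ E]]; exists (S k); exact E.
- intros u [k [E1 E2]]; rewrite <- E2 in E1; apply (ray_inj (o := r)) in E1; lia.
Defined.

Definition witness (N : digraph V) (H : nat -> digraph V) : Prop :=
  (forall l, 1 <= l -> finite_digraph (H l) /\ strongly_connected (H l)) /\
  same_digraph N (Union (fun l => 1 <= l) H) /\
  (forall l k, 1 <= l -> 1 <= k ->
     (exists v, vert (H l) v /\ vert (H k) v) <-> (l <= k + 1 /\ k <= l + 1)).

Definition necklace_with (N : digraph V) (H : nat -> digraph V) : Prop :=
  strongly_connected N /\ witness N H.

(** Only used for [1 < l]. *)
Definition interior (H : nat -> digraph V) (l : nat) : V -> Prop :=
  fun v => vert (H l) v /\ ~ vert (H (l - 1)) v /\ ~ vert (H (l + 1)) v.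

Definition ceil (R : nat -> outray) X : V -> Prop :=
  fun v => X v \/
    exists i k m, 1 <= i /\ k <= m /\ ray_at (R i) k = v /\ X (ray_at (R i) m).

Inductive staircase (R : nat -> outray) : list nat -> list V -> Prop :=
| staircase_edge i j a b :
    on_ray (R i) a -> on_ray (R j) b ->
    staircase R [i; j] [a; b]
| staircase_step i j s a b c p :
    on_ray (R i) a -> on_ray (R j) b -> arc (ray_graph (R j)) b c ->
    staircase R (j :: s) (c :: p) ->
    staircase R (i :: j :: s) (a :: b :: c :: p).

Definition simple_staircase (R : nat -> outray) (s : list nat) (P : dipath) : Prop :=
  staircase R s (pverts P).

Definition edge_between (R : nat -> outray) (i j : nat) (A : dipath) : Prop :=
  exists a b, pverts A = [a; b] /\ on_ray (R i) a /\ on_ray (R j) b.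

(** [P] is the concatenation of [S], one edge of the ray [r] and [T]. *)
Definition concat_via (r : outray) (S T P : dipath) : Prop :=
  arc (ray_graph r) (pend S) (pstart T) /\ pverts P = pverts S ++ pverts T.

Definition ascending_seq (n : nat) : list nat := seq 1 n.
Definition descending_seq (n : nat) : list nat := rev (seq 1 n).

Definition grid_graph (R : nat -> outray) (G : nat -> dipath) : digraph V :=
  union2 (Union (fun i => 1 <= i) (fun i => ray_graph (R i)))
         (Union (fun n => 2 <= n) (fun n => path_graph (G n))).

(** [R] are the vertical rays and [G] the girders. *)
Definition girded (R : nat -> outray) (G : nat -> dipath) : Prop :=
  (forall i j, 1 <= i -> 1 <= j -> i <> j -> avoids (on_ray (R i)) (on_ray (R j))) /\
  (forall i n, 2 <= i -> i < n -> avoids (on_path (G n)) (ceil R (on_path (G i)))) /\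
  (forall v, vert (grid_graph R G) v ->
     ~ ((exists! u, arc (grid_graph R G) u v) /\
        (exists! w, arc (grid_graph R G) v w))) /\
  (forall i n, 1 <= i -> 2 <= n -> ~ on_path (G n) (root (R i))).

Definition bidirected_quarter_grid (R : nat -> outray) (G : nat -> dipath) : Prop :=
  girded R G /\
  forall n, 2 <= n -> exists S' S'',
    simple_staircase R (ascending_seq n) S' /\
    simple_staircase R (descending_seq n) S'' /\
    concat_via (R n) S' S'' (G n) /\
    avoids (on_path S'') (ceil R (on_path S')).

Definition ascending_cyclic_quarter_grid (R : nat -> outray) (G : nat -> dipath) : Prop :=
  girded R G /\
  forall n, 2 <= n -> exists S A,
    simple_staircase R (ascending_seq n) S /\
    edge_between R n 1 A /\
    concat_via (R n) S A (G n) /\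
    avoids (on_path A) (ceil R (on_path S)).

Definition descending_cyclic_quarter_grid (R : nat -> outray) (G : nat -> dipath) : Prop :=
  girded R G /\
  forall n, 2 <= n -> exists A S,
    edge_between R 1 n A /\
    simple_staircase R (descending_seq n) S /\
    concat_via (R n) A S (G n) /\
    avoids (on_path S) (ceil R (on_path A)).

Definition cyclic_quarter_grid (R : nat -> outray) (G : nat -> dipath) : Prop :=
  ascending_cyclic_quarter_grid R G \/ descending_cyclic_quarter_grid R G.

Definition horizontal_arc (R : nat -> outray) (Q : digraph V) (i j : nat) (u v : V) : Prop :=
  1 <= i /\ 1 <= j /\ i <> j /\ on_ray (R i) u /\ on_ray (R j) v /\ arc Q u v.

End Digraphs.

(** [f] gives the branch vertices; [p u v] is the path replacing the edge
    [u -> v], and is irrelevant if [Q] has no such edge. *)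
Definition subdivision (W W' : Type) (Q : digraph W) (Q' : digraph W')
    (f : W -> W') (p : W -> W -> dipath W') : Prop :=
  (forall u v, vert Q u -> vert Q v -> f u = f v -> u = v) /\
  (forall u v, arc Q u v -> pstart (p u v) = f u /\ pend (p u v) = f v) /\
  (forall u v w, arc Q u v -> vert Q w -> ~ inner (p u v) (f w)) /\
  (forall u v u' v', arc Q u v -> arc Q u' v' -> (u, v) <> (u', v') ->
     avoids (inner (p u v)) (inner (p u' v'))) /\
  (forall x, vert Q' x <->
     (exists u, vert Q u /\ f u = x) \/
     (exists u v, arc Q u v /\ on_path (p u v) x)) /\
  (forall x y, arc Q' x y <->
     exists u v, arc Q u v /\ arc (path_graph (p u v)) x y).

Definition arising_ray (W W' : Type) (p : W -> W -> dipath W')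
    (r : outray W) (r' : outray W') : Prop :=
  same_digraph (ray_graph r')
    (Union (fun e : W * W => arc (ray_graph r) (fst e) (snd e))
           (fun e => path_graph (p (fst e) (snd e)))).

Section NecklaceGrids.
Variable V : Type.

(** The horizontal paths of the subdivision are the [p u v] for the horizontal
    edges [u -> v] of [Q], and [P' u v] is the path of the necklace grid put in
    place of [p u v].  [endpoints i x x'] states that [x] is the endpoint on
    the [i]-th vertical ray of some horizontal path, and that [x'] is the
    corresponding endpoint in the [i]-th vertical necklace. *)
Definition endpoints (W W' : Type) (R : nat -> outray W) (Q : digraph W)
    (p : W -> W -> dipath W') (P' : W -> W -> dipath V)
    (i : nat) (x : W') (x' : V) : Prop :=
  exists j u v,
    (horizontal_arc R Q i j u v /\ x = pstart (p u v) /\ x' = pstart (P' u v)) \/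
    (horizontal_arc R Q j i u v /\ x = pend (p u v) /\ x' = pend (P' u v)).

(** [D] arises from the subdivision, given by [p] and with vertical rays [R'],
    of the quarter-grid [Q] with vertical rays [R], by replacing the vertical
    rays by the necklaces [N i] with witnesses [H i]. *)
Definition replaces_rays (W W' : Type) (R : nat -> outray W) (Q : digraph W)
    (p : W -> W -> dipath W') (R' : nat -> outray W')
    (N : nat -> digraph V) (H : nat -> nat -> digraph V)
    (P' : W -> W -> dipath V) (D : digraph V) : Prop :=
  let horizontal := fun e : W * W => exists i j, horizontal_arc R Q i j (fst e) (snd e) in
  (forall i, 1 <= i -> necklace_with (N i) (H i)) /\
  (forall i j, 1 <= i -> 1 <= j -> i <> j -> avoids (vert (N i)) (vert (N j))) /\
  (forall i j u v, horizontal_arc R Q i j u v ->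
     vert (N i) (pstart (P' u v)) /\ vert (N j) (pend (P' u v)) /\
     forall k, 1 <= k -> avoids (inner (P' u v)) (vert (N k))) /\
  (forall e e', horizontal e -> horizontal e' -> e <> e' ->
     avoids (on_path (P' (fst e) (snd e))) (on_path (P' (fst e') (snd e')))) /\
  same_digraph D
    (union2 (Union (fun i => 1 <= i) N)
            (Union horizontal (fun e => path_graph (P' (fst e) (snd e))))) /\
  (forall i l, 1 <= i -> Nat.Odd l ->
     forall u v u' v',
       arc D u v -> ~ arc (N i) u v -> vert (H i l) u \/ vert (H i l) v ->
       arc D u' v' -> ~ arc (N i) u' v' -> vert (H i l) u' \/ vert (H i l) v' ->
       u = u' /\ v = v') /\
  (forall i l, 1 <= i -> 1 <= l -> Nat.Even l ->
     forall u v, arc D u v -> ~ arc (N i) u v ->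
       ~ (interior (H i) l u \/ interior (H i) l v)) /\
  (forall i x y x' y', 1 <= i ->
     endpoints R Q p P' i x x' -> endpoints R Q p P' i y y' ->
     precedes (R' i) x y ->
     exists k l, Nat.Odd k /\ Nat.Odd l /\ k < l /\
       vert (H i k) x' /\ vert (H i l) y').

Definition necklace_grid_over
    (quarter_grid : forall W : Type, (nat -> outray W) -> (nat -> dipath W) -> Prop)
    (D : digraph V) : Prop :=
  exists (W : Type) (R : nat -> outray W) (G : nat -> dipath W),
    quarter_grid W R G /\
    exists (W' : Type) (Q' : digraph W') (f : W -> W') (p : W -> W -> dipath W')
           (R' : nat -> outray W'),
      subdivision (grid_graph R G) Q' f p /\
      (forall i, 1 <= i -> arising_ray p (R i) (R' i)) /\
      exists (N : nat -> digraph V) (H : nat -> nat -> digraph V)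
             (P' : W -> W -> dipath V),
        replaces_rays R (grid_graph R G) p R' N H P' D.

Definition bidirected_necklace_grid : digraph V -> Prop :=
  necklace_grid_over bidirected_quarter_grid.

Definition cyclic_necklace_grid : digraph V -> Prop :=
  necklace_grid_over cyclic_quarter_grid.

End NecklaceGrids.

(* Main.v *)
(** Take the ascending cyclic quarter-grid and replace every vertical ray by a
    two-way oriented ray.  A strongly connected subgraph of the resulting grid
    that uses no back arc (an arc from column [n] to column 1) lies in a single
    column.  The least back arc of a strongly connected [K] closes a curve around
    the centre of the grid; an infinite connected subgraph disjoint from [K] lies
    outside this curve.  By symmetry, two disjoint infinite strongly connected
    subgraphs cannot both use back arcs.  Hence in a bidirected necklace grid all
    necklaces but one contain tails of distinct columns.  Of two consecutive
    ones, let [hi] be the larger column and [lo] the smaller, and let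
    [J > hi] be the column of another necklace.  Almost all of the disjoint paths
    from column [hi] to column [lo] have to pass column [J] in order to reach a
    back arc, and so meet the necklace there. *)

From Stdlib Require Import Arith List Lia Classical.
Require Import Defs.
Import ListNotations.

Set Implicit Arguments.
Unset Strict Implicit.
Unset Printing Implicit Defensive.

Definition point : Type := (nat * nat)%type.

Lemma point_eq (u v : point) : fst u = fst v -> snd u = snd v -> u = v.
Proof. destruct u, v; simpl; intros; subst; reflexivity. Qed.

Lemma point_dec (u v : point) : {u = v} + {u <> v}.
Proof. decide equality; apply Nat.eq_dec. Defined.

(** * Lists and paths *)

Definition consecutive (A : Type) (l : list A) (u v : A) : Prop :=
  exists l1 l2, l = l1 ++ u :: v :: l2.

Lemma consecutive_cons (A : Type) (a b : A) l u v :
  consecutive (a :: b :: l) u v <-> (u = a /\ v = b) \/ consecutive (b :: l) u v.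
Proof.
split.
- intros [[|c l1] [l2 E]]; simpl in E.
  + injection E as E1 E2 _; left; auto.
  + injection E as _ E; right; exists l1, l2; exact E.
- intros [[-> ->] | [l1 [l2 E]]].
  + exists [], l; reflexivity.
  + exists (a :: l1), l2; simpl; rewrite E; reflexivity.
Qed.

Lemma consecutive_single (A : Type) (a u v : A) : ~ consecutive [a] u v.
Proof. intros [[|c [|d l1]] [l2 E]]; simpl in E; discriminate E. Qed.

Lemma last_cons (A : Type) (a x : A) l : last (a :: l) x = last l a.
Proof. 
revert a x; induction l as [|b l IH]; intros a x; [reflexivity|].
change (last (b :: l) x = last (b :: l) a); rewrite !IH; reflexivity.
Qed.

Lemma list_crosses (A : Type) (S : A -> Prop) l x :
  S x -> ~ S (last l x) -> exists u v, consecutive (x :: l) u v /\ S u /\ ~ S v.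
Proof.
revert x; induction l as [|a l IH]; intros x Sx Sl; [contradiction|].
rewrite last_cons in Sl.
destruct (classic (S a)) as [Sa|Sa].
- destruct (IH a Sa Sl) as [u [v [C [Su Sv]]]].
  exists u, v; rewrite consecutive_cons; auto.
- exists x, a; rewrite consecutive_cons; auto.
Qed.

Lemma path_crosses (V : Type) (P : dipath V) (S : V -> Prop) :
  S (pstart P) -> ~ S (pend P) ->
  exists u v, arc (path_graph P) u v /\ S u /\ ~ S v.
Proof. intros; apply list_crosses; assumption. Qed.

(** The main tool for strongly connected subgraphs: with a suitable [S], listing the kinds of arcs
    that can leave [S] shows what such a subgraph must contain. *)
Lemma connected_crosses (V : Type) (G : digraph V) (S : V -> Prop) x y :
  strongly_connected G -> vert G x -> vert G y -> S x -> ~ S y ->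
  exists u v, arc G u v /\ vert G u /\ vert G v /\ S u /\ ~ S v.
Proof.
intros C Gx Gy Sx Sy; destruct (C x y Gx Gy) as [P [PG [<- <-]]].
destruct (path_crosses Sx Sy) as [u [v [a [Su Sv]]]].
apply (proj2 PG) in a; exists u, v; repeat split; auto;
  [exact (arc_tail a) | exact (arc_head a)].
Qed.

Lemma path_extend (V : Type) (G : digraph V) (P : dipath V) w :
  path_in G P -> arc G w (pstart P) -> ~ on_path P w ->
  exists P', path_in G P' /\ pstart P' = w /\ pend P' = pend P /\
             forall x, on_path P' x <-> x = w \/ on_path P x.
Proof.
intros [PV PA] a nw.
assert (D : NoDup (w :: pverts P)) by (constructor; [exact nw | exact (path_nodup P)]).
exists (Dipath D); split; [split|split; [|split]].
- intros x [<-|Px]; [exact (arc_tail a) | exact (PV x Px)].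
- intros x y C; change (consecutive (w :: pstart P :: ptail P) x y) in C.
  apply consecutive_cons in C; destruct C as [[-> ->]|C]; [exact a | exact (PA x y C)].
- reflexivity.
- unfold pend; simpl; apply last_cons.
- intros x; unfold on_path, pverts; simpl; intuition.
Qed.

(** Each element lies only in sets of nearby index, so a finite list is eventually missed. The slack
    [d] lets neighbouring beads of a witness overlap. *)
Lemma disjoint_eventually_avoids (A : Type) (X : nat -> A -> Prop) (d : nat) :
  (forall m n x, m + d <= n -> X m x -> ~ X n x) ->
  forall L : list A, exists n0, forall n, n0 <= n -> forall x, X n x -> ~ In x L.
Proof.
intros XD; induction L as [|a L [n0 IH]].
- exists 0; intros n _ x _ [].
- destruct (classic (exists m, X m a)) as [[m Xa]|nX].
  + exists (n0 + m + d); intros n ge x Xx [<-|Lx].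
    * apply (XD m n a); auto; lia.
    * apply (IH n) in Xx; [contradiction | lia].
  + exists n0; intros n ge x Xx [<-|Lx]; [eauto | exact (IH n ge x Xx Lx)].
Qed.

Lemma ex_least (P : nat -> Prop) :
  (exists n, P n) -> exists n, P n /\ forall m, m < n -> ~ P m.
Proof.
intros [n Pn]; induction n as [n IH] using lt_wf_ind.
destruct (classic (exists m, m < n /\ P m)) as [[m [lt Pm]]|no]; [eauto|].
exists n; split; [exact Pn | intros m lt Pm; eauto].
Qed.

(** * The cyclic grid *)

(** Height of the root of the [i]-th ray.  The [n]-th girder enters a column
    [i > 1] at height [4n] and leaves it at [4n+2]; it leaves column 1 at [4n+2]
    and returns to it at [4n+4].  All rays skip the odd heights, which the
    columns of the necklace grid use to separate the attachment points. *)
Definition low (i : nat) : nat := if i =? 1 then 8 else 4 * i - 2.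

Lemma low_cases i : i = 1 /\ low i = 8 \/ i <> 1 /\ low i = 4 * i - 2.
Proof. unfold low; destruct (Nat.eqb_spec i 1); auto. Qed.

Definition ray (i : nat) : outray point.
Proof.
refine (@Outray point (fun k => (i, low i + 2 * k)) _).
intros m n E; injection E; lia.
Defined.

Lemma on_rayE i v : on_ray (ray i) v <-> exists k, fst v = i /\ snd v = low i + 2 * k.
Proof.
split.
- intros [k <-]; exists k; auto.
- intros [k [E1 E2]]; exists k; apply point_eq; simpl; auto.
Qed.

Lemma ray_arcE i u v :
  arc (ray_graph (ray i)) u v <->
  exists k, fst u = i /\ fst v = i /\ snd u = low i + 2 * k /\ snd v = snd u + 2.
Proof.
split.
- intros [k [<- <-]]; exists k; simpl; lia.
- intros [k [E1 [E2 [E3 E4]]]]; exists k; split; apply point_eq; simpl; lia.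
Qed.

(** The stretch of the [n]-th girder from column [i] to its entry into column [S (i + k)], without
    the first vertex; it crosses [k] columns in between. *)
Fixpoint stair_tail (n i k : nat) : list point :=
  (S i, 4 * n) ::
  match k with 0 => [] | S k' => (S i, 4 * n + 2) :: stair_tail n (S i) k' end.

Definition stair (n i k : nat) : list point := (i, 4 * n + 2) :: stair_tail n i k.

Lemma in_stair n i k x :
  In x (stair n i k) <->
  (i <= fst x <= i + k /\ snd x = 4 * n + 2) \/
  (i < fst x <= S (i + k) /\ snd x = 4 * n).
Proof.
unfold stair; revert i; induction k as [|k IH]; intros i.
- simpl; split.
  + intros [<-|[<-|[]]]; simpl; lia.
  + intros [E|E]; [left | right; left]; apply point_eq; simpl; lia.
- change (In x ((i, 4 * n + 2) :: (S i, 4 * n) :: (S i, 4 * n + 2) :: stair_tail n (S i) k) <-> 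
    (i <= fst x <= i + S k /\ snd x = 4 * n + 2) \/ 
    (i < fst x <= S (i + S k) /\ snd x = 4 * n)).
  specialize (IH (S i)); cbn [In] in *.
  rewrite IH; split.
  + intros [<-|[<-|E]]; simpl; lia.
  + intros E.
    destruct (Nat.eq_dec (fst x) i); [left; apply point_eq; simpl; lia|].
    destruct (Nat.eq_dec (fst x) (S i)).
    * destruct E as [E|E].
      -- right; right; lia.
      -- right; left; apply point_eq; simpl; lia.
    * right; right; lia.
Qed.

Lemma stair_nodup n i k : NoDup (stair n i k).
Proof.
revert i; induction k as [|k IH]; intros i.
- repeat constructor; simpl; [intros [E|[]]; injection E; lia | auto].
- change (NoDup ((i, 4 * n + 2) :: (S i, 4 * n) :: stair n (S i) k)).
  constructor; [|constructor; [|apply IH]].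
  + intros [E|E]; [injection E; lia | apply in_stair in E; simpl in E; lia].
  + intros E; apply in_stair in E; simpl in E; lia.
Qed.

Definition stair_path n i k : dipath point := Dipath (stair_nodup n i k).

(** [n - 2 + 2] is [n] whenever [2 <= n]; for smaller [n] it stays 2, which keeps the vertices
    distinct, so that the girder is a path for every [n]. *)
Definition girder_list (n : nat) : list point :=
  stair n 1 (n - 2) ++ [(n - 2 + 2, 4 * n + 2); (1, 4 * n + 4)].

Lemma girder_nodup n : NoDup (girder_list n).
Proof.
apply NoDup_app; [apply stair_nodup | |].
- repeat constructor; simpl; [intros [E|[]]; injection E; lia | auto].
- intros x I J; apply in_stair in I.
  destruct J as [<-|[<-|[]]]; simpl in I; lia.
Qed.

Definition girder (n : nat) : dipath point :=
  @Dipath point (1, 4 * n + 2)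
    (stair_tail n 1 (n - 2) ++ [(n - 2 + 2, 4 * n + 2); (1, 4 * n + 4)])
    (girder_nodup n).

Lemma on_girder n x :
  2 <= n -> on_path (girder n) x ->
  (1 <= fst x <= n /\ snd x = 4 * n + 2) \/
  (2 <= fst x <= n /\ snd x = 4 * n) \/
  (fst x = 1 /\ snd x = 4 * n + 4).
Proof.
intros n2 I; change (In x (girder_list n)) in I.
apply in_app_or in I; destruct I as [I|[<-|[<-|[]]]]; simpl; try lia.
apply in_stair in I; lia.
Qed.

(** Appending the last two vertices of the girder lets the induction on [k] also cover the joint
    between the staircase and the back arc. *)
Lemma stair_consecutive n i k u v :
  consecutive (stair n i k ++ [(S (i + k), 4 * n + 2); (1, 4 * n + 4)]) u v <->
  (i <= fst u <= i + k /\ snd u = 4 * n + 2 /\ fst v = S (fst u) /\ snd v = 4 * n) \/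
  (i < fst u <= S (i + k) /\ snd u = 4 * n /\ fst v = fst u /\ snd v = 4 * n + 2) \/
  (fst u = S (i + k) /\ snd u = 4 * n + 2 /\ fst v = 1 /\ snd v = 4 * n + 4).
Proof.
revert i; induction k as [|k IH]; intros i.
- unfold stair; cbn [stair_tail app]; rewrite !consecutive_cons; split.
  + intros [[-> ->]|[[-> ->]|[[-> ->]|C]]]; simpl; try lia.
    apply consecutive_single in C; contradiction.
  + intros [E|[E|E]]; [left | right; left | right; right; left];
      split; apply point_eq; simpl; lia.
- change (stair n i (S k)) with ((i, 4 * n + 2) :: (S i, 4 * n) :: stair n (S i) k).
  specialize (IH (S i)); unfold stair in IH |- *; cbn [app] in IH |- *.
  replace (i + S k) with (S i + k) by lia.
  rewrite !consecutive_cons, IH; split.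
  + intros [[-> ->]|[[-> ->]|E]]; simpl; lia.
  + intros E.
    destruct (Nat.eq_dec (fst u) i) as [e|e];
      [left; split; apply point_eq; simpl; lia|].
    destruct (Nat.eq_dec (fst u) (S i)) as [e'|e']; 
      [destruct (Nat.eq_dec (snd u) (4 * n)) as [f|f]|].
    * right; left; split; apply point_eq; simpl; lia.
    * right; right; lia.
    * right; right; lia.
Qed.

(** Forward arcs of the [n]-th girder, then its back arc. *)
Definition hstep (u v : point) : Prop :=
  (exists n, 1 <= fst u < n /\ snd u = 4 * n + 2 /\ fst v = S (fst u) /\ snd v = 4 * n) \/
  (2 <= fst u /\ snd u = 4 * fst u + 2 /\ fst v = 1 /\ snd v = 4 * fst u + 4).

Lemma girder_arcE n u v :
  2 <= n ->
  arc (path_graph (girder n)) u v <->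
  (1 <= fst u < n /\ snd u = 4 * n + 2 /\ fst v = S (fst u) /\ snd v = 4 * n) \/
  (2 <= fst u <= n /\ snd u = 4 * n /\ fst v = fst u /\ snd v = 4 * n + 2) \/
  (fst u = n /\ snd u = 4 * n + 2 /\ fst v = 1 /\ snd v = 4 * n + 4).
Proof.
intros n2; change (arc (path_graph (girder n)) u v) with (consecutive (girder_list n) u v).
unfold girder_list; replace (n - 2 + 2) with (S (1 + (n - 2))) by lia.
rewrite stair_consecutive; lia.
Qed.

(** * The ascending cyclic quarter-grid and its degrees *)

Definition quarter : digraph point := grid_graph ray girder.

(** The vertical steps of a girder are ray edges already, so girders contribute only horizontal
    arcs. *)
Lemma quarter_arcE u v :
  arc quarter u v <->
  (exists k, 1 <= fst u /\ fst v = fst u /\ snd u = low (fst u) + 2 * k /\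
             snd v = snd u + 2) \/
  hstep u v.
Proof.
split.
- intros [[|] [_ [i [i1 a]]]].
  + apply ray_arcE in a; destruct a as [k E]; left; exists k.
    destruct E as [-> E]; lia.
  + apply girder_arcE in a; [|exact i1]; destruct a as [E|[E|E]].
    * right; left; exists i; lia.
    * left; exists (2 * (i - fst u) + 1).
      destruct (low_cases (fst u)); lia.
    * right; right; lia.
- intros [[k E]|[[n E]|E]].
  + exists true; split; [exact I|]; exists (fst u); split; [lia|].
    apply ray_arcE; exists k; lia.
  + exists false; split; [exact I|]; exists n; split; [lia|].
    apply girder_arcE; lia.
  + exists false; split; [exact I|]; exists (fst u); split; [lia|].
    apply girder_arcE; lia.
Qed.

Lemma on_ray_even i v :
  low i <= snd v -> fst v = i -> Nat.Even (snd v) -> on_ray (ray i) v.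
Proof.
intros le E [m Em]; apply on_rayE.
exists (m - Nat.div2 (low i)).
assert (Nat.Even (low i)) as [q Eq].
{ destruct (low_cases i) as [[_ ->]|[_ ->]]; [exists 4 | exists (2 * i - 1)]; lia. }
rewrite Eq, Nat.div2_double; lia.
Qed.

Lemma quarter_vert v :
  vert quarter v -> 1 <= fst v /\ exists k, snd v = low (fst v) + 2 * k.
Proof.
intros [[|] [_ [i [i1 a]]]].
- apply on_rayE in a; destruct a as [k [<- E]]; eauto.
- apply on_girder in a; [|exact i1].
  assert (O : on_ray (ray (fst v)) v).
  { apply on_ray_even; [destruct (low_cases (fst v)); lia | reflexivity |].
    destruct a as [E|[E|E]]; [exists (2 * i + 1) | exists (2 * i) | exists (2 * i + 2)]; lia. }
  apply on_rayE in O; destruct O as [k [_ E]]; split; [lia | eauto].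
Qed.

(** The heights are chosen so that every ray vertex except the root is an attachment point; this
    yields the degree condition. *)
Lemma nonroot_hstep v k :
  1 <= fst v -> snd v = low (fst v) + 2 * S k -> exists w, hstep v w \/ hstep w v.
Proof.
intros i1 E; destruct v as [i h]; simpl in *.
destruct (low_cases i) as [[-> L]|[ne L]]; rewrite L in E.
(* Column 1 alternates between the departure and the return of girder [q + 2]. *)
- destruct (Nat.Even_or_Odd k) as [[q K]|[q K]].
  + exists (2, 4 * (q + 2)); left; left; exists (q + 2); simpl; lia.
  + exists (q + 2, 4 * (q + 2) + 2); right; right; simpl; lia.
(* Column [i > 1] meets girder [i + q] at heights [4 * (i + q)] and [4 * (i + q) + 2]; the latter
   starts a back arc exactly if [q = 0]. *)
- destruct (Nat.Even_or_Odd k) as [[q K]|[q K]].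
  + exists (i - 1, 4 * (i + q) + 2); right; left; exists (i + q); simpl; lia.
  + destruct (Nat.eq_dec q 0).
    * exists (1, 4 * i + 4); left; right; simpl; lia.
    * exists (S i, 4 * (i + q)); left; left; exists (i + q); simpl; lia.
Qed.

(** A root has no incoming arc. Any other vertex has a vertical arc in, one out, and a horizontal
    arc besides. *)
Lemma quarter_degree v :
  vert quarter v -> ~ ((exists! u, arc quarter u v) /\ (exists! w, arc quarter v w)).
Proof.
intros Qv [[u [au Uu]] [w [aw Uw]]].
apply quarter_vert in Qv; destruct Qv as [i1 [[|k] E]].
- apply quarter_arcE in au; destruct au as [[q F]|[[n F]|F]].
  + destruct F as [_ [<- F]]; lia.
  + destruct (low_cases (fst v)); lia.
  + destruct (low_cases (fst v)); lia.
- destruct (nonroot_hstep i1 E) as [x [X|X]].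
  + assert (a : arc quarter v (fst v, snd v + 2)).
    { apply quarter_arcE; left; exists (S k); simpl; lia. }
    assert (b : arc quarter v x) by (apply quarter_arcE; auto).
    apply Uw in a; apply Uw in b; subst w x.
    destruct X as [[n X]|X]; simpl in X; lia.
  + assert (a : arc quarter (fst v, snd v - 2) v).
    { apply quarter_arcE; left; exists k; simpl; lia. }
    assert (b : arc quarter x v) by (apply quarter_arcE; auto).
    apply Uu in a; apply Uu in b; subst u x.
    destruct X as [[n X]|X]; simpl in X; lia.
Qed.

Lemma grid_girded : girded ray girder.
Proof.
split; [|split; [|split]].
- intros i j _ _ ne v I J; apply on_rayE in I; apply on_rayE in J.
  destruct I as [? [I _]], J as [? [J _]]; congruence.
- intros m n m2 lt v I [J|[i [k [l [i1 [le [E J]]]]]]].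
  + apply on_girder in I; [|lia]; apply on_girder in J; lia.
  + apply on_girder in I; [|lia]; apply on_girder in J; [|lia].
    subst v; simpl in *; lia.
- exact quarter_degree.
- intros i n i1 n2 I; apply on_girder in I; [|exact n2]; simpl in I.
  destruct (low_cases i); lia.
Qed.

Lemma stair_staircase n i k :
  1 <= i -> S (i + k) <= n -> staircase ray (seq i (k + 2)) (stair n i k).
Proof.
revert i; induction k as [|k IH]; intros i i1 le.
- apply staircase_edge; apply on_ray_even; simpl; auto;
    try (destruct (low_cases i), (low_cases (S i)); lia);
    [exists (2 * n + 1) | exists (2 * n)]; lia.
- replace (S k + 2) with (S (S (k + 1))) by lia.
  change (staircase ray (i :: S i :: seq (S (S i)) (k + 1))
    ((i, 4 * n + 2) :: (S i, 4 * n) :: (S i, 4 * n + 2) :: stair_tail n (S i) k)).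
  apply staircase_step.
  + apply on_ray_even; simpl; auto; [destruct (low_cases i); lia | exists (2 * n + 1); lia].
  + apply on_ray_even; simpl; auto; [destruct (low_cases (S i)); lia | exists (2 * n); lia].
  + apply ray_arcE; exists (2 * (n - S i) + 1); simpl.
    destruct (low_cases (S i)); lia.
  + specialize (IH (S i)); replace (k + 2) with (S (k + 1)) in IH by lia.
    apply IH; lia.
Qed.

Lemma edge_nodup (u v : point) : NoDup (u :: if point_dec u v then [] else [v]).
Proof.
destruct (point_dec u v); repeat constructor; simpl; auto.
intros [E|[]]; congruence.
Qed.

(** The single-vertex path if [u = v]. *)
Definition edge_path (u v : point) : dipath point := Dipath (edge_nodup u v).

Lemma edge_pathE u v : u <> v -> pverts (edge_path u v) = [u; v].
Proof. intros ne; unfold pverts; simpl; destruct (point_dec u v); congruence. Qed.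

Lemma edge_path_end u v : pend (edge_path u v) = v.
Proof. unfold pend; simpl; destruct (point_dec u v); auto. Qed.

Lemma on_edge_path u v x : on_path (edge_path u v) x <-> x = u \/ x = v.
Proof.
unfold on_path, pverts; simpl; destruct (point_dec u v); simpl; subst; intuition.
Qed.

Lemma edge_path_inner u v x : ~ inner (edge_path u v) x.
Proof.
intros [I [ne1 ne2]]; rewrite edge_path_end in ne2; apply on_edge_path in I; tauto.
Qed.

Lemma edge_path_arc u v x y : 
  arc (path_graph (edge_path u v)) x y <-> u <> v /\ x = u /\ y = v.
Proof.
change (consecutive (u :: if point_dec u v then [] else [v]) x y <-> u <> v /\ x = u /\ y = v).
destruct (point_dec u v) as [e|ne].
- split; [intros C; apply consecutive_single in C; contradiction | tauto].
- rewrite consecutive_cons; split; [|tauto].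
  intros [E|C]; [tauto | apply consecutive_single in C; contradiction].
Qed.

Lemma stair_pend n i k : pend (stair_path n i k) = (S (i + k), 4 * n).
Proof.
unfold pend; cbn [ptail pstart stair_path].
(* The tail is nonempty, so the default of [last] may be arbitrary, as the induction requires. *)
generalize (i, 4 * n + 2) as d; revert i; induction k as [|k IH]; intros i d.
- simpl; f_equal; lia.
- change (stair_tail n i (S k)) with ((S i, 4 * n) :: (S i, 4 * n + 2) :: stair_tail n (S i) k).
  rewrite !last_cons, IH; f_equal; lia.
Qed.

Lemma grid_cyclic : cyclic_quarter_grid ray girder.
Proof.
left; split; [exact grid_girded|]; intros n n2.
assert (ne : (n, 4 * n + 2) <> (1, 4 * n + 4)) by (intros E; injection E; lia).
exists (stair_path n 1 (n - 2)), (edge_path (n, 4 * n + 2) (1, 4 * n + 4)).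
split; [|split; [|split]].
- unfold simple_staircase, ascending_seq.
  pose proof (@stair_staircase n 1 (n - 2)) as St.
  replace (n - 2 + 2) with n in St by lia; apply St; lia.
- exists (n, 4 * n + 2), (1, 4 * n + 4); split; [exact (edge_pathE ne)|].
  split; apply on_ray_even; try reflexivity; cbn [fst snd].
  + destruct (low_cases n); lia.
  + exists (2 * n + 1); lia.
  + destruct (low_cases 1); lia.
  + exists (2 * n + 2); lia.
- split.
  + rewrite stair_pend; apply ray_arcE; exists 1; simpl.
    destruct (low_cases n); lia.
  + rewrite (edge_pathE ne); change (pverts (girder n)) with (girder_list n).
    unfold girder_list; replace (n - 2 + 2) with n by lia; reflexivity.
- intros x I C; apply on_edge_path in I.
  (* The ceiling only adds vertices below the staircase, which reaches height [4 * n] in column [n]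
     and [4 * n + 2] in column 1. *)
  assert (J : exists y, In y (stair n 1 (n - 2)) /\ fst y = fst x /\ snd x <= snd y).
  { destruct C as [C|[i [k [m [i1 [le [E C]]]]]]]; [eauto|].
    eexists; split; [exact C|]; subst x; simpl; lia. }
  destruct J as [y [J L]]; apply in_stair in J.
  destruct I as [-> | ->]; simpl in *; lia.
Qed.

(** The quarter-grid serves as its own subdivision, each edge being replaced by itself. *)
Lemma trivial_subdivision : subdivision quarter quarter (fun u => u) edge_path.
Proof.
split; [|split; [|split; [|split; [|split]]]].
- auto.
- intros u v a; split; [reflexivity | apply edge_path_end].
- intros u v w _ _; apply edge_path_inner.
- intros u v u' v' _ _ _ x I; apply edge_path_inner in I; contradiction.
- intros x; split; [intros Qx; left; eauto|].
  intros [[u [Qu <-]]|[u [v [a I]]]]; [exact Qu|].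
  apply on_edge_path in I; destruct I as [-> | ->]; [exact (arc_tail a) | exact (arc_head a)].
- intros x y; split.
  + intros a; exists x, y; split; [exact a|]; apply edge_path_arc; repeat split.
    intros ->; exact (arc_irrefl a).
  + intros [u [v [a b]]]; apply edge_path_arc in b; destruct b as [_ [-> ->]]; exact a.
Qed.

Lemma trivial_arising i : arising_ray edge_path (ray i) (ray i).
Proof.
split; split.
- intros v [k <-]; exists (ray_at (ray i) k, ray_at (ray i) (S k)); split.
  + exists k; auto.
  + apply on_edge_path; auto.
- intros u v a; exists (u, v); cbn [fst snd]; split; [exact a|].
  apply edge_path_arc; repeat split; intros ->; exact (arc_irrefl a).
- intros x [[u v] [a I]]; apply on_edge_path in I; cbn [fst snd] in *.
  destruct I as [-> | ->]; [exact (arc_tail a) | exact (arc_head a)].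
- intros x y [[u v] [a b]]; apply edge_path_arc in b; destruct b as [_ [-> ->]]; exact a.
Qed.

(** * Bidirected rays as necklaces *)

(** The two-way oriented column restricted to a set of heights. Columns and their beads both have
    this form, so connectedness is shown once. *)
Definition line (i : nat) (I : nat -> Prop) : digraph point.
Proof.
refine (@Digraph point (fun v => fst v = i /\ I (snd v))
  (fun u v => fst u = i /\ fst v = i /\ I (snd u) /\ I (snd v) /\
              (snd v = S (snd u) \/ snd u = S (snd v))) _ _ _);
  try tauto; intros u; lia.
Defined.

(** Paths are extended at their start; the height bound ensures that the new start vertex is
    fresh. *)
Lemma line_up i (I : nat -> Prop) s k :
  (forall t, s <= t <= s + k -> I t) ->
  exists P, path_in (line i I) P /\ pstart P = (i, s) /\ pend P = (i, s + k) /\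
            forall x, on_path P x -> s <= snd x.
Proof.
revert s; induction k as [|k IH]; intros s It.
- exists (edge_path (i, s) (i, s)); split; [split|].
  + intros v Pv; apply on_edge_path in Pv; assert (v = (i, s)) as -> by tauto.
    split; [reflexivity | apply It; simpl; lia].
  + intros u v a; apply edge_path_arc in a; tauto.
  + rewrite edge_path_end, Nat.add_0_r; repeat split.
    intros x Px; apply on_edge_path in Px; assert (x = (i, s)) as -> by tauto; simpl; lia.
- destruct (IH (S s)) as [P [PI [E1 [E2 L]]]]; [intros; apply It; lia|].
  destruct (@path_extend _ _ P (i, s) PI) as [P' [PI' [E1' [E2' L']]]].
  + rewrite E1; simpl; repeat split; auto; apply It; lia.
  + intros O; apply L in O; simpl in O; lia.
  + exists P'; split; [exact PI' | split; [exact E1' | split; [rewrite E2', E2; f_equal; lia |]]].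
    intros x O; apply L' in O; destruct O as [-> |O]; [simpl; lia|].
    apply L in O; lia.
Qed.

Lemma line_down i (I : nat -> Prop) s k :
  (forall t, s <= t <= s + k -> I t) ->
  exists P, path_in (line i I) P /\ pstart P = (i, s + k) /\ pend P = (i, s) /\
            forall x, on_path P x -> snd x <= s + k.
Proof.
induction k as [|k IH]; intros It.
- destruct (@line_up i I s 0 It) as [P [PI [E1 [E2 _]]]].
  exists (edge_path (i, s) (i, s)); split; [split|].
  + intros v Pv; apply on_edge_path in Pv; assert (v = (i, s)) as -> by tauto.
    split; [reflexivity | apply It; simpl; lia].
  + intros u v a; apply edge_path_arc in a; tauto.
  + rewrite edge_path_end, Nat.add_0_r; repeat split.
    intros x Px; apply on_edge_path in Px; assert (x = (i, s)) as -> by tauto; simpl; lia.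
- destruct IH as [P [PI [E1 [E2 L]]]]; [intros; apply It; lia|].
  destruct (@path_extend _ _ P (i, s + S k) PI) as [P' [PI' [E1' [E2' L']]]].
  + rewrite E1; simpl; repeat split; auto; try (apply It; lia); lia.
  + intros O; apply L in O; simpl in O; lia.
  + exists P'; split; [exact PI' | split; [exact E1' | split; [congruence |]]].
    intros x O; apply L' in O; destruct O as [-> |O]; [simpl; lia|].
    apply L in O; lia.
Qed.

Lemma line_connected i (I : nat -> Prop) :
  (forall r s t, I r -> I t -> r <= s <= t -> I s) -> strongly_connected (line i I).
Proof.
intros conv [j s] [j' t] [E1 Is] [E2 It]; simpl in *; subst j j'.
destruct (le_ge_dec s t) as [le|ge].
- destruct (@line_up i I s (t - s)) as [P [PI [E1 [E2 _]]]].
  + intros r Hr; apply (conv s r t); auto; lia.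
  + exists P; split; [exact PI | split; [exact E1 | rewrite E2; f_equal; lia]].
- destruct (@line_down i I t (s - t)) as [P [PI [E1 [E2 _]]]].
  + intros r Hr; apply (conv t r s); auto; lia.
  + exists P; split; [exact PI | split; [rewrite E1; f_equal; lia | exact E2]].
Qed.

Definition column (i : nat) : digraph point := line i (fun t => low i <= t).

(** Two adjacent heights, [low i + l - 1] and [low i + l]. Consecutive beads share one vertex, so
    interiors are empty, and an odd bead contains just one even height. *)
Definition bead (i l : nat) : digraph point :=
  line i (fun t => low i + l = t \/ low i + l = S t).

Lemma column_necklace i : necklace_with (column i) (bead i).
Proof.
split; [|split; [|split]].
- apply line_connected; intros; lia.
- intros l l1; split; [|apply line_connected; intros; lia].
  exists [(i, low i + l); (i, low i + l - 1)].
  intros [j t] [E F]; simpl in *; subst j.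
  destruct F as [<-|F]; [left; reflexivity | right; left; f_equal; lia].
- split; split.
  (* The bead with bottom [v]: the one with top [v] would have index 0 at the root. *)
  + intros v [E F]; exists (snd v - low i + 1); split; [lia|]; split; [exact E | simpl; lia].
  + intros u v [E [E' [F [F' G]]]].
    exists (if snd v <=? snd u then snd u - low i else snd v - low i).
    destruct (Nat.leb_spec (snd v) (snd u)); simpl; lia.
  + intros v [l [l1 [E F]]]; split; [exact E | simpl; lia].
  + intros u v [l [l1 a]]; simpl in *; lia.
- intros l k l1 k1; split.
  + intros [v [[_ F] [_ F']]]; lia.
  + intros le; exists (i, low i + min l k); simpl; lia.
Qed.

(** * The cyclic necklace grid *)

Definition horizontal (e : point * point) : Prop :=
  exists i j, horizontal_arc ray quarter i j (fst e) (snd e).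

Definition grid : digraph point :=
  union2 (Union (fun i => 1 <= i) column)
         (Union horizontal (fun e => path_graph (edge_path (fst e) (snd e)))).

Lemma horizontal_hstep i j u v :
  horizontal_arc ray quarter i j u v -> hstep u v /\ fst u = i /\ fst v = j.
Proof.
intros [_ [_ [ne [I [J a]]]]]; apply on_rayE in I; apply on_rayE in J.
destruct I as [? [I _]], J as [? [J _]].
apply quarter_arcE in a; destruct a as [[k E]|a]; [lia | auto].
Qed.

Lemma horizontal_heights i j u v :
  horizontal_arc ray quarter i j u v -> low i <= snd u /\ low j <= snd v.
Proof.
intros [_ [_ [_ [I [J _]]]]]; apply on_rayE in I; apply on_rayE in J.
destruct I as [? [_ I]], J as [? [_ J]]; lia.
Qed.

(** The height modulo 4 tells heads from tails. A head in column 1, or a tail in column [i] at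
    height [4 * i + 2], belongs to a back arc; the rest belong to forward arcs. *)
Lemma hstep_unique u v u' v' x :
  hstep u v -> hstep u' v' -> x = u \/ x = v -> x = u' \/ x = v' -> u = u' /\ v = v'.
Proof.
intros [[n A]|A] [[n' A']|A'] [-> | ->] [E|E];
  pose proof (f_equal fst E); pose proof (f_equal snd E);
  try (exfalso; lia); split; apply point_eq; lia.
Qed.

Lemma hstep_even u v x : hstep u v -> x = u \/ x = v -> Nat.Even (snd x).
Proof.
intros [[n A]|A] [-> | ->].
- exists (2 * n + 1); lia.
- exists (2 * n); lia.
- exists (2 * fst u + 1); lia.
- exists (2 * fst u + 2); lia.
Qed.

Lemma low_even i : Nat.Even (low i).
Proof.
destruct (low_cases i) as [[_ ->]|[_ ->]]; [exists 4 | exists (2 * i - 1)]; lia.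
Qed.

Lemma grid_arc u v :
  arc grid u v -> (exists i, 1 <= i /\ arc (column i) u v) \/ hstep u v.
Proof.
intros [[|] [_ a]]; [left; exact a|].
destruct a as [e [[i [j h]] a]]; apply edge_path_arc in a; destruct a as [_ [-> ->]].
apply horizontal_hstep in h; tauto.
Qed.

Lemma grid_bead_arc i l u v :
  arc grid u v -> ~ arc (column i) u v -> vert (bead i l) u \/ vert (bead i l) v ->
  hstep u v.
Proof.
intros a na B; apply grid_arc in a; destruct a as [[k [_ a]]|]; [|assumption].
assert (k = i) by (simpl in *; lia); subst k; contradiction.
Qed.

(** Attachment heights and [low i] are even, which leaves only the bottom of an odd bead. *)
Lemma bead_odd_attachment i l u v :
  Nat.Odd l -> hstep u v -> vert (bead i l) u \/ vert (bead i l) v ->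
  exists x, (x = u \/ x = v) /\ x = (i, low i + l - 1).
Proof.
intros [m ->] h B; destruct (low_even i) as [q Q].
destruct (@hstep_even u v u h (or_introl eq_refl)) as [r Hr].
destruct (@hstep_even u v v h (or_intror eq_refl)) as [r' Hr'].
destruct B as [B|B]; [exists u | exists v]; split; auto; apply point_eq; simpl in *; lia.
Qed.

Lemma endpointsE i x x' :
  endpoints ray quarter edge_path edge_path i x x' -> x = x'.
Proof.
intros [j [u [v [[_ [-> ->]]|[_ [-> ->]]]]]]; reflexivity.
Qed.

Lemma grid_replaces : 
  replaces_rays ray quarter edge_path ray column bead edge_path grid.
Proof.
split; [|split; [|split; [|split; [|split; [|split; [|split]]]]]].
- intros i _; apply column_necklace.
- intros i j _ _ ne v [I _] [J _]; congruence.
- intros i j u v h; rewrite edge_path_end; pose proof (horizontal_heights h).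
  apply horizontal_hstep in h; simpl; repeat split; try tauto.
  intros k _ x I; apply edge_path_inner in I; contradiction.
- intros [u v] [u' v'] [i [j h]] [i' [j' h']] ne x I I'.
  apply horizontal_hstep in h; apply horizontal_hstep in h'.
  apply on_edge_path in I; apply on_edge_path in I'; simpl in *.
  apply ne; destruct (@hstep_unique u v u' v' x) as [-> ->]; tauto.
- split; split; auto.
- intros i l _ ol u v u' v' a na B a' na' B'.
  pose proof (grid_bead_arc a na B) as h; pose proof (grid_bead_arc a' na' B') as h'.
  destruct (bead_odd_attachment ol h B) as [x [X E]].
  destruct (bead_odd_attachment ol h' B') as [x' [X' E']].
  subst x'; subst x; exact (hstep_unique h h' X X').
- intros i l _ l1 _ u v _ _ [[A [B C]]|[A [B C]]]; simpl in *; lia.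
- intros i x y x' y' i1 X Y [m [n [lt [E F]]]].
  apply endpointsE in X; apply endpointsE in Y; subst x' y' x y.
  (* Position [m] of the ray has height [low i + 2 * m], the bottom of bead [2 * m + 1]. *)
  exists (2 * m + 1), (2 * n + 1); repeat split;
    [exists m; lia | exists n; lia | lia | simpl; lia | simpl; lia].
Qed.

Lemma grid_cyclic_necklace : cyclic_necklace_grid grid.
Proof.
exists point, ray, girder; split; [exact grid_cyclic|].
exists point, quarter, (fun u => u), edge_path, ray.
split; [exact trivial_subdivision|]; split; [intros; apply trivial_arising|].
exists column, bead, edge_path; exact grid_replaces.
Qed.

(** * Strongly connected subgraphs of the grid *)

(** A necessary condition for arcs of the grid that forgets where the columns start; the arguments
    on connected subgraphs rest on it. *)
Definition step (u v : point) : Prop :=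
  (fst u = fst v /\ (snd v = S (snd u) \/ snd u = S (snd v))) \/ hstep u v.

Lemma grid_step u v : arc grid u v -> step u v.
Proof.
intros a; apply grid_arc in a; destruct a as [[i [_ a]]|h]; [left | right; exact h].
simpl in a; lia.
Qed.

Definition has_back (K : digraph point) (n : nat) : Prop :=
  2 <= n /\ arc K (n, 4 * n + 2) (1, 4 * n + 4).

Definition infinite (K : digraph point) : Prop :=
  forall L : list point, exists v, vert K v /\ ~ In v L.

(** If [n] is the least index of a back arc of [K], this is the region inside
    the innermost closed curve of [K] around the centre of the grid. *)
Definition below (K : digraph point) (n : nat) (v : point) : Prop :=
  1 <= fst v <= n /\ forall s, s <= snd v -> ~ vert K (fst v, s).

Section Subgraph.
Variable K : digraph point.
Hypothesis K_connected : strongly_connected K.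
Hypothesis K_step : forall u v, arc K u v -> step u v.

Lemma back_index k u v :
  arc K u v -> 2 <= k -> fst u = k -> snd u = 4 * k + 2 -> fst v = 1 ->
  snd v = 4 * k + 4 -> has_back K k.
Proof.
intros a k2 E1 E2 E3 E4; split; [exact k2|].
replace (k, 4 * k + 2) with u by (apply point_eq; auto).
replace (1, 4 * k + 4) with v by (apply point_eq; auto).
exact a.
Qed.

(** Only back arcs lead to a smaller column. *)
Lemma one_column u v :
  (forall n, ~ has_back K n) -> vert K u -> vert K v -> fst u = fst v.
Proof.
intros nb.
assert (W : forall x y, vert K x -> vert K y -> fst x < fst y -> False).
{ intros x y Kx Ky lt.
  destruct (@connected_crosses _ K (fun z => fst y <= fst z) y x K_connected Ky Kx)
    as [a [b [ab [_ [_ [Sa Sb]]]]]]; try lia.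
  destruct (K_step ab) as [E|[[n E]|E]]; try lia.
  apply (nb (fst a)); apply (back_index ab); lia. }
intros Ku Kv; destruct (lt_eq_lt_dec (fst u) (fst v)) as [[lt|eq]|gt]; auto;
  exfalso; eauto.
Qed.

(** Infinitely many vertices in one column reach arbitrary heights, and a path inside a column
    changes height by one at a time. *)
Lemma column_tail j :
  infinite K -> (forall v, vert K v -> fst v = j) ->
  exists t0, forall t, t0 <= t -> vert K (j, t).
Proof.
intros inf col; destruct (inf []) as [[j' t0] [K0 _]].
assert (E := col _ K0); simpl in E; subst j'.
exists t0; intros t le.
destruct (inf (list_prod [j] (seq 0 t))) as [[j' t'] [Kt nin]].
assert (E := col _ Kt); simpl in E; subst j'.
assert (ge : t <= t').
{ destruct (le_lt_dec t t') as [|lt]; [assumption|].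
  destruct nin; apply in_prod; [left; reflexivity | apply in_seq; lia]. }
destruct (Nat.eq_dec t0 t) as [<-|ne]; [exact K0|].
destruct (@connected_crosses _ K (fun z => snd z < t) (j, t0) (j, t') K_connected K0 Kt)
  as [a [b [ab [Ka [Kb [Sa Sb]]]]]]; simpl; try lia.
apply col in Ka; assert (Eb := col b Kb).
destruct (K_step ab) as [E|[[n E]|E]].
- replace (j, t) with b by (apply point_eq; simpl; lia); exact Kb.
- lia.
- lia.
Qed.

(** * The region inside the least back arc *)

Section Least.
Variable n : nat.
Hypothesis back_n : has_back K n.
Hypothesis least : forall m, m < n -> ~ has_back K m.

Lemma back_tail : vert K (n, 4 * n + 2).
Proof. exact (arc_tail (proj2 back_n)). Qed.

Lemma back_head : vert K (1, 4 * n + 4).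
Proof. exact (arc_head (proj2 back_n)). Qed.

(** A path from the head of the back arc to its tail leads from column 1 to column [n], and a
    forward arc advances by a single column. *)
Lemma hits_column i : 1 <= i <= n -> exists s, vert K (i, s).
Proof.
intros [i1 le]; destruct (Nat.eq_dec i 1) as [->|ne]; [eexists; exact back_head|].
destruct (@connected_crosses _ K (fun z => fst z < i) _ _ K_connected back_head back_tail)
  as [a [b [ab [_ [Kb [Sa Sb]]]]]]; simpl; try lia.
assert (fst b = i) by (destruct (K_step ab) as [E|[[m E]|E]]; lia).
exists (snd b); replace (i, snd b) with b by (apply point_eq; auto); exact Kb.
Qed.

Lemma below_bounded :
  exists M, forall v, below K n v -> snd v < M.
Proof.
assert (B : forall m, m <= n ->
  exists M, forall i, 1 <= i <= m -> exists s, s < M /\ vert K (i, s)).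
{ induction m as [|m IH]; intros le; [exists 0; lia|].
  destruct IH as [M HM]; [lia|].
  destruct (@hits_column (S m)) as [s Ks]; [lia|].
  exists (M + S s); intros i Hi.
  destruct (Nat.eq_dec i (S m)) as [->|ne]; [exists s; split; [lia | exact Ks]|].
  destruct (HM i) as [s' [lt Ks']]; [lia|]; exists s'; split; [lia | exact Ks']. }
destruct (B n) as [M HM]; [lia|].
exists M; intros v [Hv no]; destruct (HM _ Hv) as [s [lt Ks]].
destruct (le_lt_dec s (snd v)) as [le|]; [|lia].
destruct (no s le Ks).
Qed.

(* In each case, a vertex of [K] on the wrong side of the arc [u -> v] would
   have to be left or reached, within [K], through [u], [v] or a back arc of
   index less than [n]. *)
Lemma below_closed u v :
  step u v -> ~ vert K u -> ~ vert K v -> (below K n u <-> below K n v).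
Proof.
intros st nu nv.
pose proof back_tail as Kt; pose proof back_head as Kh; destruct back_n as [n2 _].
assert (is_u : forall x, vert K x -> fst x = fst u -> snd x = snd u -> False).
{ intros x Kx E1 E2; apply nu; rewrite <- (@point_eq x u); assumption. }
assert (is_v : forall x, vert K x -> fst x = fst v -> snd x = snd v -> False).
{ intros x Kx E1 E2; apply nv; rewrite <- (@point_eq x v); assumption. }
destruct st as [E|[[k E]|E]].
- split; intros [C no]; (split; [lia|]); intros s le Ks.
  + destruct (le_lt_dec s (snd u)) as [le'|].
    * apply (no s le'); replace (fst u) with (fst v) by lia; exact Ks.
    * apply (is_v _ Ks); simpl; lia.
  + destruct (le_lt_dec s (snd v)) as [le'|].
    * apply (no s le'); replace (fst v) with (fst u) by lia; exact Ks.
    * apply (is_u _ Ks); simpl; lia.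
- split; intros [C no].
  (* Girder [k] goes beyond column [fst u], so in column [n] the vertex [u] would lie above the tail
     of the least back arc. *)
  + assert (fst u <> n).
    { intros e; apply (no (4 * n + 2)); [lia | rewrite e; exact Kt]. }
    split; [lia|]; intros s le Ks.
    assert (s <> 4 * k) by (intros e; apply (is_v _ Ks); simpl; lia).
    destruct (@connected_crosses _ K (fun z => ~ (fst z = fst v /\ snd z < 4 * k))
                _ _ K_connected Kh Ks) as [a [b [ab [Ka [Kb [Sa Sb]]]]]]; simpl; try lia.
    apply NNPP in Sb.
    destruct (K_step ab) as [F|[[r F]|F]].
    * apply (is_v _ Ka); lia.
    * apply (no (snd a)); [lia|]; replace (fst u) with (fst a) by lia.
      destruct a; exact Ka.
    * lia.
  + split; [lia|]; intros s le Ks.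
    assert (s <> 4 * k + 2) by (intros e; apply (is_u _ Ks); simpl; lia).
    destruct (@connected_crosses _ K (fun z => fst z = fst u /\ snd z < 4 * k + 2)
                _ _ K_connected Ks Kt) as [a [b [ab [Ka [Kb [Sa Sb]]]]]]; simpl; try lia.
    destruct (K_step ab) as [F|[[r F]|F]].
    * apply (is_u _ Kb); lia.
    * apply (no (snd b)); [lia|]; replace (fst v) with (fst b) by lia.
      destruct b; exact Kb.
    * apply (least (m := fst u)); [lia|]; apply (back_index ab); lia.
- split; intros [C no].
  + assert (fst u <> n) by (intros e; apply (is_u _ Kt); simpl; lia).
    split; [lia|]; intros s le Ks.
    assert (s <> snd v) by (intros e; apply (is_v _ Ks); simpl; lia).
    destruct (@connected_crosses _ K (fun z => ~ (fst z = fst v /\ snd z < snd v))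
                _ _ K_connected Kt Ks) as [a [b [ab [Ka [Kb [Sa Sb]]]]]]; simpl; try lia.
    apply NNPP in Sb.
    destruct (K_step ab) as [F|[[r F]|F]].
    * apply (is_v _ Ka); lia.
    * lia.
    * apply (least (m := fst a)); [lia|]; apply (back_index ab); lia.
  (* The head of the least back arc caps the region in column 1, so this arc starts in a column
     before [n]. *)
  + assert (snd v < 4 * n + 4).
    { destruct (le_lt_dec (4 * n + 4) (snd v)) as [le|]; [|assumption].
      destruct (no _ le); replace (fst v) with 1 by lia; exact Kh. }
    split; [lia|]; intros s le Ks.
    assert (s <> snd u) by (intros e; apply (is_u _ Ks); simpl; lia).
    destruct (@connected_crosses _ K (fun z => fst z = fst u /\ snd z < snd u)
                _ _ K_connected Ks Kt) as [a [b [ab [Ka [Kb [Sa Sb]]]]]]; simpl; try lia.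
    destruct (K_step ab) as [F|[[r F]|F]].
    * apply (is_u _ Kb); lia.
    * lia.
    * lia.
Qed.

(** By [below_closed], [K'] cannot leave the region once it meets it, but the region is finite. *)
Lemma disjoint_not_below (K' : digraph point) :
  strongly_connected K' -> (forall u v, arc K' u v -> step u v) -> infinite K' ->
  avoids (vert K') (vert K) -> forall v, vert K' v -> ~ below K n v.
Proof.
intros C' st' inf dis v Kv Bv.
destruct below_bounded as [M HM].
destruct (inf (list_prod (seq 0 (S n)) (seq 0 M))) as [w [Kw nin]].
destruct (@connected_crosses _ K' (below K n) v w C' Kv Kw Bv)
  as [a [b [ab [Ka [Kb [Sa Sb]]]]]].
- intros Bw; apply nin; pose proof (HM w Bw); destruct w as [i t], Bw as [Bw _].
  cbn [fst snd] in *; apply in_prod; apply in_seq; lia.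
- apply Sb; apply (below_closed (st' _ _ ab)); auto.
Qed.

End Least.
End Subgraph.

(** The lowest vertex of the two subgraphs in column 1 would lie in the region of the one not
    containing it. Hence both miss column 1, where every back arc ends. *)
Lemma disjoint_back (K K' : digraph point) :
  strongly_connected K -> strongly_connected K' ->
  (forall u v, arc K u v -> step u v) -> (forall u v, arc K' u v -> step u v) ->
  infinite K -> infinite K' -> avoids (vert K) (vert K') ->
  (exists n, has_back K n) -> (exists n, has_back K' n) -> False.
Proof.
intros C C' st st' inf inf' dis b b'.
destruct (ex_least b) as [n [bn ln]], (ex_least b') as [n' [bn' ln']].
assert (dis' : avoids (vert K') (vert K)) by (intros x I J; exact (dis x J I)).
assert (no : forall s, ~ vert K (1, s) /\ ~ vert K' (1, s)).
{ induction s as [s IH] using lt_wf_ind.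
  split; intros Ks.
  - apply (disjoint_not_below C' st' bn' ln' C st inf dis Ks).
    destruct bn'; split; [simpl; lia|]; simpl; intros r le Kr.
    destruct (Nat.eq_dec r s) as [->|ne]; [exact (dis _ Ks Kr)|].
    exact (proj2 (IH r ltac:(lia)) Kr).
  - apply (disjoint_not_below C st bn ln C' st' inf' dis' Ks).
    destruct bn; split; [simpl; lia|]; simpl; intros r le Kr.
    destruct (Nat.eq_dec r s) as [->|ne]; [exact (dis _ Kr Ks)|].
    exact (proj1 (IH r ltac:(lia)) Kr). }
exact (proj1 (no (4 * n + 4)) (arc_head (proj2 bn))).
Qed.

(** * Bidirected necklace grids *)

(** Beads at distance at least 2 are disjoint, so late ones miss [L], and the intersection condition
    for equal indices makes them nonempty. *)
Lemma witness_infinite (N : digraph point) H : witness N H -> infinite N.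
Proof.
intros [_ [[_ [HN _]] meet]] L.
destruct (@disjoint_eventually_avoids _ (fun l v => vert (H (S l)) v) 2) with (L := L)
  as [l0 av].
- intros m l x le Hm Hl.
  assert (M : S m <= S l + 1 /\ S l <= S m + 1) by (apply meet; [lia | lia | eauto]); lia.
- destruct (proj2 (meet (S l0) (S l0) ltac:(lia) ltac:(lia)) ltac:(lia)) as [v [Hv _]].
  exists v; split; [|apply (av l0); auto].
  apply HN; exists (S l0); split; [lia | exact Hv].
Qed.

Lemma staircase_arc (V : Type) (R : nat -> outray V) s l :
  staircase R s l -> forall i j, consecutive s i j ->
  exists u v, consecutive l u v /\ on_ray (R i) u /\ on_ray (R j) v.
Proof.
induction 1 as [a b x y ox oy | a b s x y z p ox oy yz st IH]; intros i j C.
- apply consecutive_cons in C; destruct C as [[-> ->]|C].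
  + exists x, y; rewrite consecutive_cons; auto.
  + apply consecutive_single in C; contradiction.
- apply consecutive_cons in C; destruct C as [[-> ->]|C].
  + exists x, y; rewrite consecutive_cons; auto.
  + destruct (IH i j C) as [u [v [D E]]]; exists u, v; split; [|exact E].
    rewrite !consecutive_cons; auto.
Qed.

Lemma consecutive_app_l (A : Type) (l l' : list A) u v :
  consecutive l u v -> consecutive (l ++ l') u v.
Proof. intros [l1 [l2 ->]]; exists l1, (l2 ++ l'); rewrite <- app_assoc; reflexivity. Qed.

Lemma consecutive_app_r (A : Type) (l l' : list A) u v :
  consecutive l' u v -> consecutive (l ++ l') u v.
Proof. intros [l1 [l2 ->]]; exists (l ++ l1), l2; rewrite <- app_assoc; reflexivity. Qed.

Lemma consecutive_rev (A : Type) (l : list A) u v :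
  consecutive l u v -> consecutive (rev l) v u.
Proof.
intros [l1 [l2 ->]]; exists (rev l2), (rev l1).
rewrite rev_app_distr; simpl; rewrite <- !app_assoc; reflexivity.
Qed.

Lemma consecutive_seq i n : 1 <= i < n -> consecutive (seq 1 n) i (S i).
Proof.
intros lt; exists (seq 1 (i - 1)), (seq (S (S i)) (n - i - 1)).
replace n with ((i - 1) + S (S (n - i - 1))) at 1 by lia.
rewrite seq_app; f_equal; replace (1 + (i - 1)) with i by lia; reflexivity.
Qed.

(** * Linking paths between neighbouring necklaces *)

Section Bidirected.
Variables (W : Type) (R : nat -> outray W) (G : nat -> dipath W).
Hypothesis RG : bidirected_quarter_grid R G.

(** Bidirectedness enters here: the ascending and the descending staircase of one girder link
    neighbouring rays in both directions. *)
Lemma girder_horizontal i j n :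
  1 <= i <= n -> 1 <= j <= n -> i = S j \/ j = S i -> 
  exists u v, on_path (G n) u /\ horizontal_arc R (grid_graph R G) i j u v.
Proof.
intros Hi Hj ij; destruct (proj2 RG n) as [S' [S'' [st' [st'' [[_ E] _]]]]]; [lia|].
assert (X : exists u v, consecutive (pverts (G n)) u v /\ on_ray (R i) u /\ on_ray (R j) v).
{ rewrite E; destruct ij as [-> | ->].
  - destruct (staircase_arc st'' (i := S j) (j := j)) as [u [v [C O]]].
    + apply consecutive_rev, consecutive_seq; lia.
    + exists u, v; split; [apply consecutive_app_r; exact C | exact O].
  - destruct (staircase_arc st' (i := i) (j := S i)) as [u [v [C O]]].
    + apply consecutive_seq; lia.
    + exists u, v; split; [apply consecutive_app_l; exact C | exact O]. }
destruct X as [u [v [C [Ou Ov]]]].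
assert (a : arc (path_graph (G n)) u v) by exact C.
exists u, v; split; [exact (arc_tail a)|].
repeat split; try lia; auto.
exists false; split; [exact I|]; exists n; split; [lia | exact a].
Qed.

Variables (W' : Type) (p : W -> W -> dipath W') (R' : nat -> outray W').
Variables (V : Type) (N : nat -> digraph V) (H : nat -> nat -> digraph V).
Variables (P' : W -> W -> dipath V) (B : digraph V).
Hypothesis rep : replaces_rays R (grid_graph R G) p R' N H P' B.

(** Every late girder provides such a path, and these paths are disjoint, so all but finitely many
    miss [L]. *)
Lemma linking_path i j (L : list V) :
  1 <= i -> 1 <= j -> i = S j \/ j = S i ->
  exists P : dipath V, path_in B P /\ vert (N i) (pstart P) /\ vert (N j) (pend P) /\
    (forall k, 1 <= k -> avoids (inner P) (vert (N k))) /\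
    (forall x, on_path P x -> ~ In x L).
Proof.
intros i1 j1 ij; destruct rep as [_ [_ [ends [dis [[_ [BV BA]] _]]]]].
(* The shift by [i + j] ensures that the girder reaches both rays. *)
set (X := fun n x => exists u v, on_path (G (n + i + j)) u /\
  horizontal_arc R (grid_graph R G) i j u v /\ on_path (P' u v) x).
destruct (@disjoint_eventually_avoids _ X 1) with (L := L) as [n av].
- intros m n x lt [u [v [Gu [h Px]]]] [u' [v' [Gu' [h' Px']]]].
  (* Distinct girders are disjoint, so their horizontal arcs have distinct tails. *)
  assert (ne : u <> u').
  { intros <-; destruct RG as [[_ [dG _]] _].
    apply (dG (m + i + j) (n + i + j)) with (v := u); [lia | lia | exact Gu' | left; exact Gu]. }
  apply (dis (u, v) (u', v')) with (v := x); simpl; auto; try congruence;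
    exists i, j; assumption.
- destruct (@girder_horizontal i j (n + i + j)) as [u [v [Gu h]]]; try lia.
  destruct (ends _ _ _ _ h) as [Es [Ee Ei]].
  exists (P' u v); split; [|repeat split; auto].
  + split.
    * intros x Px; apply BV; exists false; split; [exact I|].
      exists (u, v); split; [exists i, j; exact h | exact Px].
    * intros x y Px; apply BA; exists false; split; [exact I|].
      exists (u, v); split; [exists i, j; exact h | exact Px].
  + intros x Px; apply (av n); [lia | exists u, v; auto].
Qed.

End Bidirected.

(** * Excluding bidirected necklace grids *)

Lemma grid_no_bidirected (B : digraph point) :
  subgraph B grid -> bidirected_necklace_grid B -> False.
Proof.
intros [_ BD] [W [R [G [RG [W' [Q' [f [p [R' [_ [_ [N [H [P' rep]]]]]]]]]]]]]].
pose proof (linking_path RG rep) as link.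
destruct rep as [neck [disN [_ [_ [[_ [_ BA]] _]]]]].
assert (conn : forall i, 1 <= i -> strongly_connected (N i)) by (intros i i1; apply (neck i i1)).
assert (inf : forall i, 1 <= i -> infinite (N i)).
{ intros i i1; eapply witness_infinite, (neck i i1). }
assert (st : forall i, 1 <= i -> forall u v, arc (N i) u v -> step u v).
{ intros i i1 u v a; apply grid_step, BD, BA; exists true; split; [exact I|].
  exists i; split; [exact i1 | exact a]. }
(* By [disjoint_back] at most one necklace has a back arc; [i0] is chosen after it. *)
assert (ev : exists i0, 1 <= i0 /\ forall i, i0 <= i -> forall n, ~ has_back (N i) n).
{ destruct (classic (exists w n, 1 <= w /\ has_back (N w) n)) as [[w [n [w1 b]]]|no].
  - exists (S w); split; [lia|]; intros i lt n' b'.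
    assert (i1 : 1 <= i) by lia.
    apply (disjoint_back (conn w w1) (conn i i1) (st w w1) (st i i1) (inf w w1) (inf i i1));
      [apply disN; lia | eauto | eauto].
  - exists 1; split; [lia|]; intros i i1 n b; eauto. }
destruct ev as [i0 [i01 nb]].
assert (col : forall i, i0 <= i ->
  exists j t0, (forall v, vert (N i) v -> fst v = j) /\
               forall t, t0 <= t -> vert (N i) (j, t)).
{ intros i le; destruct (inf i ltac:(lia) []) as [v [Nv _]].
  assert (C : forall w, vert (N i) w -> fst w = fst v).
  { intros w Nw; apply (@one_column (N i)); auto; [apply conn | apply st]; lia. }
  destruct (@column_tail (N i) (conn i ltac:(lia)) (st i ltac:(lia)) (fst v))
    as [t0 T]; [apply inf; lia | exact C|].
  exists (fst v), t0; auto. }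
assert (distinct : forall i k j t t', i0 <= i -> i0 <= k -> i <> k ->
  (forall s, t <= s -> vert (N i) (j, s)) -> (forall s, t' <= s -> vert (N k) (j, s)) -> False).
{ intros i k j t t' le le' ne T T'.
  apply (disN i k ltac:(lia) ltac:(lia) ne (j, t + t')); [apply T | apply T']; lia. }
(* Neighbours are linked in both directions, so [a] can be whichever of the two lies in the larger
   column. *)
assert (pair : exists a b hi lo, (a = S b \/ b = S a) /\ i0 <= a /\ i0 <= b /\ lo < hi /\
  (forall v, vert (N a) v -> fst v = hi) /\ (forall v, vert (N b) v -> fst v = lo)).
{ destruct (col i0) as [j [t [C T]]]; [lia|].
  destruct (col (S i0)) as [j' [t' [C' T']]]; [lia|].
  destruct (lt_eq_lt_dec j j') as [[lt|eq]|gt].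
  - exists (S i0), i0, j', j; repeat split; auto.
  - subst j'; exfalso; apply (distinct i0 (S i0) j t t'); auto.
  - exists i0, (S i0), j, j'; repeat split; auto. }
destruct pair as [a [b [hi [lo [ab [a0 [b0 [lt [Ca Cb]]]]]]]]].
(* Distinct necklaces have tails in distinct columns, so only finitely many have theirs in columns
   up to [hi]. *)
destruct (@disjoint_eventually_avoids _
  (fun m j => exists t0, forall t, t0 <= t -> vert (N (m + i0)) (j, t)) 1)
  with (L := seq 0 (S hi)) as [c far].
{ intros m n j le [t T] [t' T']; apply (distinct (m + i0) (n + i0) j t t'); auto; lia. }
destruct (col (c + i0)) as [J [t0 [_ T]]]; [lia|].
assert (ltJ : hi < J).
{ destruct (le_lt_dec J hi) as [le|]; [|assumption].
  destruct (far c ltac:(lia) J); [eauto | apply in_seq; lia]. }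
(* The box to be avoided contains all back arcs from columns up to [J], and column [J] up to where
   the necklace there is known to fill it. *)
destruct (link a b (list_prod (seq 0 (S J)) (seq 0 (S (t0 + 4 * J + 4)))))
  as [P [PB [Ps [Pe [Pi PL]]]]]; [lia | lia | exact ab |].
assert (high : forall x, on_path P x -> fst x <= J -> t0 + 4 * J + 4 < snd x).
{ intros [x y] Px le; cbn [fst snd] in *.
  destruct (le_lt_dec y (t0 + 4 * J + 4)) as [le'|]; [|assumption].
  destruct (PL _ Px); apply in_prod; apply in_seq; lia. }
apply Ca in Ps; apply Cb in Pe.
destruct (@path_crosses _ P (fun z => hi <= fst z < J)) as [u [v [uv [Su Sv]]]]; try lia.
assert (Pu := high u (arc_tail uv)); assert (Pv := high v (arc_head uv)).
(* A vertical arc stays among the columns from [hi] to [J - 1], and a back arc from there starts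
   inside the box; so [u -> v] enters column [J]. *)
destruct (grid_step (BD _ _ (proj2 PB _ _ uv))) as [E|[[n E]|E]]; try lia.
(* Both ends of [P] lie in columns smaller than [J], so [v] is an inner vertex of [P] on a
   necklace. *)
apply (Pi (c + i0) ltac:(lia) v).
- split; [exact (arc_head uv)|]; split; intros ->; lia.
- replace v with (J, snd v) by (apply point_eq; simpl; lia); apply T; lia.
Qed.

Theorem lemma7p1 :
  exists (V : Type) (D : digraph V),
    cyclic_necklace_grid D /\
    ~ (exists B : digraph V, subgraph B D /\ bidirected_necklace_grid B).
Proof.
exists point, grid; split; [exact grid_cyclic_necklace|].
intros [B [sub bid]]; exact (grid_no_bidirected sub bid).
Qed.
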